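(* The simplification phase $\Phi_{\mathtt{emptyDirt}}$ is complete. Explicitly, let $\Xi$ be a reduced context, $F=(F^+,F^-)$ a pair of sets of type and dirt parameters of $\Xi$, and $\mathcal D$ a set of dirt parameters of $\Xi$ such that $\delta\notin F^-$ for each $\delta\in\mathcal D$ and such that $\Xi$ contains no dirt coercion parameter $\varpi:\delta'\le O\cup\delta$ with $\delta\in\mathcal D$ and $\delta'\notin\mathcal D$. Let $\sigma$ be the substitution with $\sigma(\delta)=\emptyset$ for each $\delta\in\mathcal D$, with $\sigma(\varpi)=\emptyset_{\sigma(\Delta)}$ for each $(\varpi:\delta\le\Delta)\in\Xi$ with $\delta\in\mathcal D$, and identity on all other parameters, and let $\sigma(\Xi)$ be $\Xi$ with all $\delta\in\mathcal D$ and all these $\varpi$ removed. Then for every instantiation $\vdash\eta:\Xi\Rightarrow\Xi_{\mathrm{use}}$ there exist an instantiation $\vdash\eta':\sigma(\Xi)\Rightarrow\Xi_{\mathrm{use}}$ and a coercion family $Y$ with $\Xi_{\mathrm{use}}\vdash Y:(\eta'\circ\sigma)\le_F\eta$.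
   Context: SYNTAX. Fix a global signature $\Sigma$: a finite set of operations $op$. There are parameters of five kinds: skeleton $\varsigma$, dirt $\delta$, type $\alpha$, dirt coercion $\varpi$, type coercion $\omega$. Skeletons: $S::=\varsigma\mid\mathtt{Unit}\mid S_1\to S_2$. Dirts: $\Delta::=\delta\mid\emptyset\mid\{op\}\cup\Delta$, considered up to reordering and repetition of operations, so each dirt is $O$ or $O\cup\delta$ with $O$ a finite set of operations (possibly empty). Value types: $A::=\alpha\mid\mathtt{Unit}\mid A\to C$; computation types: $C::=A\,!\,\Delta$. A (parameter) context $\Xi$ is a finite list of distinct parameters: $\varsigma$; $\delta$; $\alpha:S$; $\varpi:\Delta_1\le\Delta_2$; $\omega:A_1\le A_2$. $\Xi\vdash S\ \mathtt{skel}$ (resp. $\Xi\vdash\Delta\ \mathtt{dirt}$) means all parameters of $S$ (resp. $\Delta$) are in $\Xi$ and all operations in $\Delta$ are in $\Sigma$. $\Xi\vdash A:S$ and $\Xi\vdash C:S$ (with $\Xi\vdash S\ \mathtt{skel}$) are given by: $\alpha:S$ if $(\alpha:S)\in\Xi$; $\mathtt{Unit}:\mathtt{Unit}$; $A\to C:S_1\to S_2$ if $A:S_1$, $C:S_2$; $A\,!\,\Delta:S$ if $A:S$ and $\Xi\vdash\Delta\ \mathtt{dirt}$. $\Xi$ is well-formed if all skeletons and dirts occurring in it are well-formed in $\Xi$ and for each $\omega:A_1\le A_2$ in $\Xi$ both $A_i$ have a common skeleton in $\Xi$. All contexts are assumed well-formed. A context is reduced if every type parameter in it is of the form $\alpha:\varsigma$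 with $\varsigma$ a skeleton parameter, every type coercion parameter is of the form $\omega:\alpha_1\le\alpha_2$ with $\alpha_1,\alpha_2$ type parameters, and every dirt coercion parameter is of the form $\varpi:\delta_1\le O$ or $\varpi:\delta_1\le O\cup\delta_2$. COERCIONS. Dirt coercions $\gamma_d::=\varpi\mid\gamma_d^2\circ\gamma_d^1\mid\langle\delta\rangle\mid\langle\emptyset\rangle\mid\emptyset_\delta\mid\{op\}\cup\gamma_d\mid\{op\}\cup^+\gamma_d$; value coercions $\gamma_v::=\omega\mid\gamma_v^2\circ\gamma_v^1\mid\langle\alpha\rangle\mid\langle\mathtt{Unit}\rangle\mid\gamma_v\to\gamma_c$; computation coercions $\gamma_c::=\gamma_v\,!\,\gamma_d$. Rules in context $\Xi$ (both sides are presupposed well-formed, and for types of the same skeleton): $\varpi,\omega$ have the inequality declared in $\Xi$; $\gamma^2\circ\gamma^1:X\le Z$ if $\gamma^1:X\le Y$, $\gamma^2:Y\le Z$; $\langle\delta\rangle:\delta\le\delta$; $\langle\emptyset\rangle:\emptyset\le\emptyset$; $\emptyset_\delta:\emptyset\le\delta$; if $\gamma_d:\Delta\le\Delta'$ then $\{op\}\cup\gamma_d:\{op\}\cup\Delta\le\{op\}\cup\Delta'$ and $\{op\}\cup^+\gamma_d:\Delta\le\{op\}\cup\Delta'$; $\langle\alpha\rangle:\alpha\le\alpha$; $\langle\mathtt{Unit}\rangle:\mathtt{Unit}\le\mathtt{Unit}$; $\gamma_v\to\gamma_c:(A\to C)\le(A'\to C')$ if $\gamma_v:A'\le A$, $\gamma_c:C\le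 C'$; $\gamma_v\,!\,\gamma_d:(A\,!\,\Delta)\le(A'\,!\,\Delta')$ if $\gamma_v:A\le A'$, $\gamma_d:\Delta\le\Delta'$. For arbitrary dirts and types define $\emptyset_\emptyset=\langle\emptyset\rangle$, $\emptyset_{\{op\}\cup\Delta}=\{op\}\cup^+\emptyset_\Delta$ (so $\emptyset_\Delta:\emptyset\le\Delta$), $\langle\{op\}\cup\Delta\rangle=\{op\}\cup\langle\Delta\rangle$, $\langle A\to C\rangle=\langle A\rangle\to\langle C\rangle$, $\langle A\,!\,\Delta\rangle=\langle A\rangle\,!\,\langle\Delta\rangle$. SUBSTITUTIONS. A valid substitution $\vdash\sigma:\Xi\Rightarrow\Xi'$ assigns to every parameter of $\Xi$: to $\varsigma$ a skeleton with $\Xi'\vdash\sigma(\varsigma)\ \mathtt{skel}$; to $\delta$ a dirt with $\Xi'\vdash\sigma(\delta)\ \mathtt{dirt}$; to $\alpha:S$ a value type with $\Xi'\vdash\sigma(\alpha):\sigma(S)$; to $\varpi:\Delta_1\le\Delta_2$ a coercion $\Xi'\vdash\sigma(\varpi):\sigma(\Delta_1)\le\sigma(\Delta_2)$; to $\omega:A_1\le A_2$ a coercion $\Xi'\vdash\sigma(\omega):\sigma(A_1)\le\sigma(A_2)$. It acts homomorphically on skeletons, dirts, types, coercions (with $\sigma(\langle\delta\rangle)=\langle\sigma(\delta)\rangle$, $\sigma(\langle\alpha\rangle)=\langle\sigma(\alpha)\rangle$, $\sigma(\emptyset_\delta)=\emptyset_{\sigma(\delta)}$). Composition: $(\sigma'\circ\sigma)(p)=\sigma'(\sigma(p))$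 for each parameter $p$. COERCION FAMILIES. A coercion family $Y$ assigns a value coercion $Y(\alpha)$ to each type parameter and a dirt coercion $Y(\delta)$ to each dirt parameter. For $\vdash\sigma_1,\sigma_2:\Xi\Rightarrow\Xi'$ and a pair $F=(F^+,F^-)$ of sets of type and dirt parameters, $\Xi'\vdash Y:\sigma_1\le_F\sigma_2$ means: for each type or dirt parameter $p\in F^+$, $\Xi'\vdash Y(p):\sigma_1(p)\le\sigma_2(p)$, and for each $p\in F^-$, $\Xi'\vdash Y(p):\sigma_2(p)\le\sigma_1(p)$. PHASES. A phase $\Phi$ takes a context $\Xi$ and a pair $F$ of sets of type and dirt parameters, and (on inputs to which it applies) returns $\Phi(\Xi,F)=(\Xi',\sigma)$ with $\vdash\sigma:\Xi\Rightarrow\Xi'$. Fix a context $\Xi_{\mathrm{use}}$; an instantiation of $\Xi$ is a valid substitution $\vdash\eta:\Xi\Rightarrow\Xi_{\mathrm{use}}$. $\Phi$ is complete if whenever $\Phi(\Xi,F)=(\Xi',\sigma)$, for every instantiation $\eta$ of $\Xi$ there are an instantiation $\eta'$ of $\Xi'$ and a coercion family $\Xi_{\mathrm{use}}\vdash Y:(\eta'\circ\sigma)\le_F\eta$. $\Phi_{\mathtt{emptyDirt}}$ returns $(\sigma(\Xi),\sigma)$ as in the claim. *)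

(* Defs.v *)
From mathcomp Require Import all_boot.
From mathcomp Require Import finmap.
From Stdlib Require List.

Set Implicit Arguments.
Unset Strict Implicit.
Unset Printing Implicit Defensive.

Local Open Scope fset_scope.

(* Names of the five kinds of parameters: skeleton, dirt, type, dirt coercion
   and type coercion parameters. *)
Definition svar := nat.
Definition dvar := nat.
Definition tvar := nat.
Definition dcvar := nat.
Definition tcvar := nat.

(* Operations range over Op, and a signature is a finite set Sigma of
   operations. *)

Inductive skel : Type :=
| SVar of svar
| SUnit
| SArr of skel & skel.

(* Dirts are taken up to reordering and repetition of operations: [Dirt O None]
   is the closed dirt O, and [Dirt O (Some d)] is O \cup d. *)
Record dirt (Op : choiceType) : Type := Dirt {
  dops : {fset Op};
  dtail : option dvar }.

Definition DVar (Op : choiceType) (d : dvar) : dirt Op := Dirt fset0 (Some d).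
Definition DEmpty (Op : choiceType) : dirt Op := Dirt fset0 None.
Arguments DEmpty {Op}.
Definition DCons (Op : choiceType) (op : Op) (D : dirt Op) : dirt Op :=
  Dirt (op |` dops D) (dtail D).

Inductive vty (Op : choiceType) : Type :=
| TVar of tvar
| TUnit
| TArr of vty Op & cty Op
with cty (Op : choiceType) : Type :=
| CTy of vty Op & dirt Op.
Arguments TVar {Op}.
Arguments TUnit {Op}.

Inductive decl (Op : choiceType) : Type :=
| DeclS of svar
| DeclD of dvar
| DeclT of tvar & skel
| DeclDC of dcvar & dirt Op & dirt Op
| DeclTC of tcvar & vty Op & vty Op.
Arguments DeclS {Op}.
Arguments DeclD {Op}.
Arguments DeclT {Op}.

Definition ctx (Op : choiceType) : Type := seq (decl Op).

Inductive param : Type :=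
| PS of svar
| PD of dvar
| PT of tvar
| PDC of dcvar
| PTC of tcvar.

Definition decl_param (Op : choiceType) (x : decl Op) : param :=
  match x with
  | DeclS s => PS s
  | DeclD d => PD d
  | DeclT a _ => PT a
  | DeclDC w _ _ => PDC w
  | DeclTC w _ _ => PTC w
  end.

Fixpoint wf_skel (Op : choiceType) (Xi : ctx Op) (S : skel) : Prop :=
  match S with
  | SVar s => List.In (DeclS s) Xi
  | SUnit => True
  | SArr S1 S2 => wf_skel Xi S1 /\ wf_skel Xi S2
  end.

Definition wf_dirt (Op : choiceType) (Sigma : {fset Op}) (Xi : ctx Op)
    (D : dirt Op) : Prop :=
  dops D `<=` Sigma /\
  match dtail D with
  | Some d => List.In (DeclD d) Xi
  | None => True
  end.

Inductive vty_skel (Op : choiceType) (Sigma : {fset Op}) (Xi : ctx Op) :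
    vty Op -> skel -> Prop :=
| VS_var a S :
    List.In (DeclT a S) Xi -> wf_skel Xi S ->
    vty_skel Sigma Xi (TVar a) S
| VS_unit :
    vty_skel Sigma Xi TUnit SUnit
| VS_arr A C S1 S2 :
    vty_skel Sigma Xi A S1 -> cty_skel Sigma Xi C S2 ->
    vty_skel Sigma Xi (TArr A C) (SArr S1 S2)
with cty_skel (Op : choiceType) (Sigma : {fset Op}) (Xi : ctx Op) :
    cty Op -> skel -> Prop :=
| CS_ty A D S :
    vty_skel Sigma Xi A S -> wf_dirt Sigma Xi D ->
    cty_skel Sigma Xi (CTy A D) S.

(* The dirts occurring in a declared inequality of types are well-formed because
   they occur in types that have a skeleton. *)
Definition wf_ctx (Op : choiceType) (Sigma : {fset Op}) (Xi : ctx Op) : Prop :=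
  [/\ List.NoDup (List.map (@decl_param Op) Xi),
      forall a S, List.In (DeclT a S) Xi -> wf_skel Xi S,
      forall w D1 D2, List.In (DeclDC w D1 D2) Xi ->
        wf_dirt Sigma Xi D1 /\ wf_dirt Sigma Xi D2
    & forall w A1 A2, List.In (DeclTC w A1 A2) Xi ->
        exists S, vty_skel Sigma Xi A1 S /\ vty_skel Sigma Xi A2 S].

Definition reduced (Op : choiceType) (Xi : ctx Op) : Prop :=
  [/\ forall a S, List.In (DeclT a S) Xi -> exists s, S = SVar s,
      forall w A1 A2, List.In (DeclTC w A1 A2) Xi ->
        exists a1 a2, A1 = TVar a1 /\ A2 = TVar a2
    & forall w D1 D2, List.In (DeclDC w D1 D2) Xi ->
        exists d1, D1 = DVar Op d1].

Inductive dco (Op : choiceType) : Type :=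
| DCVar of dcvar
| DCComp of dco Op & dco Op
| DCReflVar of dvar
| DCReflEmpty
| DCEmptyVar of dvar
| DCCons of Op & dco Op
| DCConsR of Op & dco Op.
Arguments DCVar {Op}.
Arguments DCReflVar {Op}.
Arguments DCReflEmpty {Op}.
Arguments DCEmptyVar {Op}.

Inductive vco (Op : choiceType) : Type :=
| VCVar of tcvar
| VCComp of vco Op & vco Op
| VCReflVar of tvar
| VCReflUnit
| VCArr of vco Op & cco Op
with cco (Op : choiceType) : Type :=
| CCo of vco Op & dco Op.
Arguments VCVar {Op}.
Arguments VCReflVar {Op}.
Arguments VCReflUnit {Op}.

(* In [DCComp g2 g1] and [VCComp g2 g1], as in g2 \circ g1, g1 comes first.

   The side conditions of the leaf rules are such that, in a well-formed
   context, both sides of a derivable inequality are well-formed and, for types,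
   have a common skeleton. *)
Inductive dco_le (Op : choiceType) (Sigma : {fset Op}) (Xi : ctx Op) :
    dco Op -> dirt Op -> dirt Op -> Prop :=
| DL_var w D1 D2 :
    List.In (DeclDC w D1 D2) Xi ->
    wf_dirt Sigma Xi D1 -> wf_dirt Sigma Xi D2 ->
    dco_le Sigma Xi (DCVar w) D1 D2
| DL_comp g2 g1 D1 D2 D3 :
    dco_le Sigma Xi g1 D1 D2 -> dco_le Sigma Xi g2 D2 D3 ->
    dco_le Sigma Xi (DCComp g2 g1) D1 D3
| DL_reflvar d :
    List.In (DeclD d) Xi ->
    dco_le Sigma Xi (DCReflVar d) (DVar Op d) (DVar Op d)
| DL_reflempty :
    dco_le Sigma Xi DCReflEmpty DEmpty DEmpty
| DL_emptyvar d :
    List.In (DeclD d) Xi ->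
    dco_le Sigma Xi (DCEmptyVar d) DEmpty (DVar Op d)
| DL_cons op g D1 D2 :
    op \in Sigma -> dco_le Sigma Xi g D1 D2 ->
    dco_le Sigma Xi (DCCons op g) (DCons op D1) (DCons op D2)
| DL_consr op g D1 D2 :
    op \in Sigma -> dco_le Sigma Xi g D1 D2 ->
    dco_le Sigma Xi (DCConsR op g) D1 (DCons op D2).

Inductive vco_le (Op : choiceType) (Sigma : {fset Op}) (Xi : ctx Op) :
    vco Op -> vty Op -> vty Op -> Prop :=
| VL_var w A1 A2 S :
    List.In (DeclTC w A1 A2) Xi ->
    vty_skel Sigma Xi A1 S -> vty_skel Sigma Xi A2 S ->
    vco_le Sigma Xi (VCVar w) A1 A2
| VL_comp g2 g1 A1 A2 A3 :
    vco_le Sigma Xi g1 A1 A2 -> vco_le Sigma Xi g2 A2 A3 ->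
    vco_le Sigma Xi (VCComp g2 g1) A1 A3
| VL_reflvar a S :
    List.In (DeclT a S) Xi -> wf_skel Xi S ->
    vco_le Sigma Xi (VCReflVar a) (TVar a) (TVar a)
| VL_reflunit :
    vco_le Sigma Xi VCReflUnit TUnit TUnit
| VL_arr gv gc A C A' C' :
    vco_le Sigma Xi gv A' A -> cco_le Sigma Xi gc C C' ->
    vco_le Sigma Xi (VCArr gv gc) (TArr A C) (TArr A' C')
with cco_le (Op : choiceType) (Sigma : {fset Op}) (Xi : ctx Op) :
    cco Op -> cty Op -> cty Op -> Prop :=
| CL_co gv gd A D A' D' :
    vco_le Sigma Xi gv A A' -> dco_le Sigma Xi gd D D' ->
    cco_le Sigma Xi (CCo gv gd) (CTy A D) (CTy A' D').

(* The recursion over the operations of a dirt uses each operation once, in the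
   canonical enumeration of the finite set of its operations. *)
Definition dco_empty (Op : choiceType) (D : dirt Op) : dco Op :=
  foldr (@DCConsR Op)
    (match dtail D with Some d => DCEmptyVar d | None => DCReflEmpty end)
    (enum_fset (dops D)).

Definition dco_refl (Op : choiceType) (D : dirt Op) : dco Op :=
  foldr (@DCCons Op)
    (match dtail D with Some d => DCReflVar d | None => DCReflEmpty end)
    (enum_fset (dops D)).

Fixpoint vco_refl (Op : choiceType) (A : vty Op) : vco Op :=
  match A with
  | TVar a => VCReflVar a
  | TUnit => VCReflUnit
  | TArr A C => VCArr (vco_refl A) (cco_refl C)
  end
with cco_refl (Op : choiceType) (C : cty Op) : cco Op :=
  match C with
  | CTy A D => CCo (vco_refl A) (dco_refl D)
  end.

(* A substitution is represented by total functions on names; only its values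
   at the parameters of its domain context are meaningful. *)
Record subst (Op : choiceType) : Type := Subst {
  ss : svar -> skel;
  sd : dvar -> dirt Op;
  st : tvar -> vty Op;
  sdc : dcvar -> dco Op;
  stc : tcvar -> vco Op }.

Fixpoint sub_skel (Op : choiceType) (s : subst Op) (S : skel) : skel :=
  match S with
  | SVar x => ss s x
  | SUnit => SUnit
  | SArr S1 S2 => SArr (sub_skel s S1) (sub_skel s S2)
  end.

Definition sub_dirt (Op : choiceType) (s : subst Op) (D : dirt Op) : dirt Op :=
  match dtail D with
  | Some d => Dirt (dops D `|` dops (sd s d)) (dtail (sd s d))
  | None => D
  end.

Fixpoint sub_vty (Op : choiceType) (s : subst Op) (A : vty Op) : vty Op :=
  match A with
  | TVar a => st s a
  | TUnit => TUnit
  | TArr A C => TArr (sub_vty s A) (sub_cty s C)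
  end
with sub_cty (Op : choiceType) (s : subst Op) (C : cty Op) : cty Op :=
  match C with
  | CTy A D => CTy (sub_vty s A) (sub_dirt s D)
  end.

Fixpoint sub_dco (Op : choiceType) (s : subst Op) (g : dco Op) : dco Op :=
  match g with
  | DCVar w => sdc s w
  | DCComp g2 g1 => DCComp (sub_dco s g2) (sub_dco s g1)
  | DCReflVar d => dco_refl (sd s d)
  | DCReflEmpty => DCReflEmpty
  | DCEmptyVar d => dco_empty (sd s d)
  | DCCons op g => DCCons op (sub_dco s g)
  | DCConsR op g => DCConsR op (sub_dco s g)
  end.

Fixpoint sub_vco (Op : choiceType) (s : subst Op) (g : vco Op) : vco Op :=
  match g with
  | VCVar w => stc s w
  | VCComp g2 g1 => VCComp (sub_vco s g2) (sub_vco s g1)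
  | VCReflVar a => vco_refl (st s a)
  | VCReflUnit => VCReflUnit
  | VCArr gv gc => VCArr (sub_vco s gv) (sub_cco s gc)
  end
with sub_cco (Op : choiceType) (s : subst Op) (g : cco Op) : cco Op :=
  match g with
  | CCo gv gd => CCo (sub_vco s gv) (sub_dco s gd)
  end.

Definition sub_comp (Op : choiceType) (s' s : subst Op) : subst Op :=
  Subst (fun x => sub_skel s' (ss s x))
        (fun d => sub_dirt s' (sd s d))
        (fun a => sub_vty s' (st s a))
        (fun w => sub_dco s' (sdc s w))
        (fun w => sub_vco s' (stc s w)).

(* All contexts are assumed to be well-formed, hence so are the domain and the
   codomain of a valid substitution. *)
Record valid_subst (Op : choiceType) (Sigma : {fset Op}) (s : subst Op)
    (Xi Xi' : ctx Op) : Prop := ValidSubst {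
  valid_dom : wf_ctx Sigma Xi;
  valid_cod : wf_ctx Sigma Xi';
  valid_ss : forall x, List.In (DeclS x) Xi -> wf_skel Xi' (ss s x);
  valid_sd : forall d, List.In (DeclD d) Xi -> wf_dirt Sigma Xi' (sd s d);
  valid_st : forall a S, List.In (DeclT a S) Xi ->
    vty_skel Sigma Xi' (st s a) (sub_skel s S);
  valid_sdc : forall w D1 D2, List.In (DeclDC w D1 D2) Xi ->
    dco_le Sigma Xi' (sdc s w) (sub_dirt s D1) (sub_dirt s D2);
  valid_stc : forall w A1 A2, List.In (DeclTC w A1 A2) Xi ->
    vco_le Sigma Xi' (stc s w) (sub_vty s A1) (sub_vty s A2) }.

Record cofamily (Op : choiceType) : Type := Cofamily {
  yt : tvar -> vco Op;
  yd : dvar -> dco Op }.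

(* Finite sets of type and dirt parameters: [inl a] is the type parameter a and
   [inr d] is the dirt parameter d. *)
Definition tdset : Type := {fset (tvar + dvar)%type}.

(* The pair (F^+, F^-). *)
Definition polarity : Type := (tdset * tdset)%type.

(* Xi' |- Y : s1 <=_F s2, for valid substitutions s1 and s2 from Xi to Xi'. *)
Record family_le (Op : choiceType) (Sigma : {fset Op}) (Xi Xi' : ctx Op)
    (Y : cofamily Op) (F : polarity) (s1 s2 : subst Op) : Prop := FamilyLe {
  family_valid1 : valid_subst Sigma s1 Xi Xi';
  family_valid2 : valid_subst Sigma s2 Xi Xi';
  family_tpos : forall a, inl a \in F.1 ->
    vco_le Sigma Xi' (yt Y a) (st s1 a) (st s2 a);
  family_dpos : forall d, inr d \in F.1 ->
    dco_le Sigma Xi' (yd Y d) (sd s1 d) (sd s2 d);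
  family_tneg : forall a, inl a \in F.2 ->
    vco_le Sigma Xi' (yt Y a) (st s2 a) (st s1 a);
  family_dneg : forall d, inr d \in F.2 ->
    dco_le Sigma Xi' (yd Y d) (sd s2 d) (sd s1 d) }.

(* A phase is given by the relation "on input (Xi, F) it may return (Xi', s)";
   it need not apply to every input. *)
Definition transformation (Op : choiceType) : Type :=
  ctx Op -> polarity -> ctx Op -> subst Op -> Prop.

Definition is_phase (Op : choiceType) (Sigma : {fset Op})
    (Phi : transformation Op) : Prop :=
  forall Xi F Xi' s, Phi Xi F Xi' s -> valid_subst Sigma s Xi Xi'.

Definition complete (Op : choiceType) (Sigma : {fset Op}) (Xiuse : ctx Op)
    (Phi : transformation Op) : Prop :=
  forall Xi F Xi' s, Phi Xi F Xi' s ->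
  forall eta, valid_subst Sigma eta Xi Xiuse ->
  exists eta' Y,
    valid_subst Sigma eta' Xi' Xiuse /\
    family_le Sigma Xi Xiuse Y F (sub_comp eta' s) eta.

Definition td_of_ctx (Op : choiceType) (Xi : ctx Op) (F : tdset) : Prop :=
  (forall a, inl a \in F -> exists S, List.In (DeclT a S) Xi) /\
  (forall d, inr d \in F -> List.In (DeclD d) Xi).

(* D is exactly a dirt parameter that belongs to Dset. *)
Definition dirt_var_in (Op : choiceType) (Dset : {fset dvar}) (D : dirt Op) :
    bool :=
  (dops D == fset0) && (if dtail D is Some d then d \in Dset else false).

Fixpoint dc_bounds (Op : choiceType) (Xi : ctx Op) (w : dcvar) :
    option (dirt Op * dirt Op) :=
  match Xi with
  | [::] => None
  | DeclDC w' D1 D2 :: Xi' =>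
      if w' == w then Some (D1, D2) else dc_bounds Xi' w
  | _ :: Xi' => dc_bounds Xi' w
  end.

Definition emptyDirt_sd (Op : choiceType) (Dset : {fset dvar}) (d : dvar) :
    dirt Op :=
  if d \in Dset then DEmpty else DVar Op d.

(* On dirts, the substitution defined next only depends on its dirt component,
   which is what the auxiliary substitution provides. *)
Definition emptyDirt_subst (Op : choiceType) (Xi : ctx Op)
    (Dset : {fset dvar}) : subst Op :=
  let s0 := Subst SVar (emptyDirt_sd Op Dset) TVar DCVar VCVar in
  Subst SVar (emptyDirt_sd Op Dset) TVar
    (fun w =>
       if dc_bounds Xi w is Some (D1, D2) then
         if dirt_var_in Dset D1 then dco_empty (sub_dirt s0 D2) else DCVar w
       else DCVar w)
    VCVar.

Definition emptyDirt_keep (Op : choiceType) (Dset : {fset dvar})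
    (x : decl Op) : bool :=
  match x with
  | DeclD d => d \notin Dset
  | DeclDC _ D1 _ => ~~ dirt_var_in Dset D1
  | _ => true
  end.

Definition emptyDirt_ctx (Op : choiceType) (Xi : ctx Op) (Dset : {fset dvar}) :
    ctx Op :=
  filter (emptyDirt_keep Dset) Xi.

Record emptyDirt_applies (Op : choiceType) (Sigma : {fset Op}) (Xi : ctx Op)
    (F : polarity) (Dset : {fset dvar}) : Prop := EmptyDirtApplies {
  emptyDirt_wf : wf_ctx Sigma Xi;
  emptyDirt_reduced : reduced Xi;
  emptyDirt_pos : td_of_ctx Xi F.1;
  emptyDirt_neg : td_of_ctx Xi F.2;
  emptyDirt_dirts : forall d : dvar, d \in Dset -> List.In (DeclD d) Xi;
  emptyDirt_nonneg : forall d : dvar, d \in Dset -> inr d \notin F.2;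
  emptyDirt_closed : forall w d' O d,
    List.In (DeclDC w (DVar Op d') (Dirt O (Some d))) Xi ->
    d \in Dset -> d' \in Dset }.

(* Every admissible choice of the set of emptied dirt parameters is a possible
   run of the phase. *)
Definition emptyDirt (Op : choiceType) (Sigma : {fset Op}) :
    transformation Op :=
  fun Xi F Xi' s =>
    exists Dset : {fset dvar},
      [/\ emptyDirt_applies Sigma Xi F Dset,
          Xi' = emptyDirt_ctx Xi Dset
        & s = emptyDirt_subst Xi Dset].

(* Main.v *)
Require Import Defs.
From mathcomp Require Import all_boot.
From mathcomp Require Import finmap.

(** An instantiation of the original context, restricted to the remaining
    parameters, is itself the required instantiation of the simplified context.
    The two substitutions then differ only at the emptied dirt parameters, where
    the coercion family consists of the coercions [dco_empty]; since no emptied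
    parameter is negative, reflexivity does the rest. Closure of the emptied set
    under lower bounds guarantees that a remaining dirt coercion parameter does
    not mention any emptied parameter. *)

Set Implicit Arguments.
Unset Strict Implicit.
Unset Printing Implicit Defensive.

Local Open Scope fset_scope.

Lemma In_filter (T : Type) (p : pred T) (x : T) (s : seq T) :
  List.In x (filter p s) <-> List.In x s /\ p x.
Proof. exact: List.filter_In. Qed.

Lemma NoDup_map_filter (T U : Type) (f : T -> U) (p : pred T) (s : seq T) :
  List.NoDup (List.map f s) -> List.NoDup (List.map f (filter p s)).
Proof.
elim: s => [//|x s IHs] /= /List.NoDup_cons_iff [xNs s_uniq].
case: (p x) => /=; last exact: IHs.
constructor; last exact: IHs.
move=> /List.in_map_iff [y [fyx /In_filter [ys _]]]; apply: xNs.
by apply/List.in_map_iff; exists y.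
Qed.

Lemma fset_seqE (T : choiceType) (s : seq T) (A : {fset T}) :
  s =i A -> [fset x in s] = A.
Proof. by move=> sA; apply/fsetP => x; rewrite !inE. Qed.

(** * Typing of the derived coercions out of the empty dirt and of reflexivity *)

Section Coercions.
Variables (Op : choiceType) (Sigma : {fset Op}) (Xi : ctx Op).
Implicit Types (D : dirt Op) (g : dco Op) (l : seq Op).

(** The base coercion [g] is arbitrary so that the lemma covers both the leaves of [dco_empty] and
    what a substitution puts in their place. *)
Lemma dco_le_foldr_consR g D1 D2 l :
  {subset l <= Sigma} -> dco_le Sigma Xi g D1 D2 ->
  dco_le Sigma Xi (foldr (@DCConsR Op) g l) D1
    (Dirt ([fset x in l] `|` dops D2) (dtail D2)).
Proof.
move=> + g_le; elim: l => [|op l IHl] /= lS.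
  suff -> : [fset x in [::]] `|` dops D2 = dops D2 by case: D2 g_le.
  by apply/fsetP => x; rewrite !inE.
have := DL_consr (lS op (mem_head _ _))
  (IHl (fun x xl => lS x (@mem_behead _ (op :: l) x xl))).
by rewrite /DCons /= fset_cons fsetUA.
Qed.

Lemma dco_le_foldr_cons g D1 D2 l :
  {subset l <= Sigma} -> dco_le Sigma Xi g D1 D2 ->
  dco_le Sigma Xi (foldr (@DCCons Op) g l)
    (Dirt ([fset x in l] `|` dops D1) (dtail D1))
    (Dirt ([fset x in l] `|` dops D2) (dtail D2)).
Proof.
move=> + g_le; elim: l => [|op l IHl] /= lS.
  have nilU (A : {fset Op}) : [fset x in [::]] `|` A = A.
    by apply/fsetP => x; rewrite !inE.
  by rewrite !nilU; case: D1 g_le => ? ?; case: D2.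
have := DL_cons (lS op (mem_head _ _))
  (IHl (fun x xl => lS x (@mem_behead _ (op :: l) x xl))).
by rewrite /DCons /= fset_cons !fsetUA.
Qed.

Lemma dco_emptyP D :
  wf_dirt Sigma Xi D -> dco_le Sigma Xi (dco_empty D) DEmpty D.
Proof.
case: D => O t [/= /fsubsetP OS t_wf].
rewrite /dco_empty /=; case: t t_wf => [d|] t_wf.
  by have := dco_le_foldr_consR OS (DL_emptyvar _ t_wf);
    rewrite /= fsetU0 (@fset_seqE _ _ O).
by have := dco_le_foldr_consR OS (DL_reflempty Sigma Xi);
    rewrite /= fsetU0 (@fset_seqE _ _ O).
Qed.

Lemma dco_reflP D : wf_dirt Sigma Xi D -> dco_le Sigma Xi (dco_refl D) D D.
Proof.
case: D => O t [/= /fsubsetP OS t_wf].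
rewrite /dco_refl /=; case: t t_wf => [d|] t_wf.
  by have := dco_le_foldr_cons OS (DL_reflvar _ t_wf);
    rewrite /= fsetU0 (@fset_seqE _ _ O).
by have := dco_le_foldr_cons OS (DL_reflempty Sigma Xi);
    rewrite /= fsetU0 (@fset_seqE _ _ O).
Qed.

(** The recursion follows the skeleton derivation, since its leaves carry the well-formedness that
    the reflexivity rules require. *)
Fixpoint vco_reflP A S (AS : vty_skel Sigma Xi A S) {struct AS} :
  vco_le Sigma Xi (vco_refl A) A A
with cco_reflP C S (CS : cty_skel Sigma Xi C S) {struct CS} :
  cco_le Sigma Xi (cco_refl C) C C.
Proof.
- case: AS => [a S' aXi S'wf||A' C S1 S2 A'S CS] /=.
  + exact: VL_reflvar aXi S'wf.
  + exact: VL_reflunit.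
  + by apply: VL_arr; [apply: vco_reflP A'S | apply: cco_reflP CS].
- case: CS => A D S' AS' Dwf /=.
  by apply: CL_co; [apply: vco_reflP AS' | apply: dco_reflP].
Qed.

End Coercions.

(** * Interaction of substitution with dirts and their coercions *)

Section Substitution.
Variables (Op : choiceType) (Sigma : {fset Op}).
Implicit Types (D : dirt Op) (s : subst Op).

Lemma sub_dirt_comp s s' D :
  sub_dirt (sub_comp s' s) D = sub_dirt s' (sub_dirt s D).
Proof.
case: D => O [d|] //=; rewrite /sub_dirt /=.
by case: (sd s d) => O' [d'|] //=; rewrite fsetUA.
Qed.

Lemma sub_dirt_DVar s d : sub_dirt s (DVar Op d) = sd s d.
Proof. by rewrite /sub_dirt /= fset0U; case: (sd s d). Qed.

(** In general [sub_dco s (dco_empty D)] is not literally [dco_empty (sub_dirt s D)]: it lists the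
    operations of [D] and then those of the substituted tail, perhaps with repetitions. Only the two
    ends of the inequality agree, so the typing is derived directly. *)
Lemma sub_dco_empty s (Xi Xi' : ctx Op) D :
  (forall d, List.In (DeclD d) Xi -> wf_dirt Sigma Xi' (sd s d)) ->
  wf_dirt Sigma Xi D ->
  dco_le Sigma Xi' (sub_dco s (dco_empty D)) DEmpty (sub_dirt s D).
Proof.
move=> s_wf; case: D => O t [/= /fsubsetP OS t_wf].
have sub_foldr g l : sub_dco s (foldr (@DCConsR Op) g l) =
    foldr (@DCConsR Op) (sub_dco s g) l.
  by elim: l => //= op l ->.
rewrite /dco_empty sub_foldr /sub_dirt /=; case: t t_wf => [d|] t_wf /=.
  have := dco_le_foldr_consR OS (dco_emptyP (s_wf d t_wf)).
  by rewrite (@fset_seqE _ _ O).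
have := dco_le_foldr_consR OS (DL_reflempty Sigma Xi').
by rewrite fsetU0 (@fset_seqE _ _ O).
Qed.

(** The lookup stops at the first declaration of [w]; distinctness of parameters makes it the only
    one. *)
Lemma dc_boundsP (Xi : ctx Op) w D1 D2 :
  List.NoDup (List.map (@decl_param Op) Xi) ->
  List.In (DeclDC w D1 D2) Xi -> dc_bounds Xi w = Some (D1, D2).
Proof.
elim: Xi => [//|x Xi IHXi] /= /List.NoDup_cons_iff [xNXi Xi_uniq] [xE|wXi].
  by rewrite xE eqxx.
case: x xNXi => /= [?|?|? ?|w' ? ?|? ? ?] xNXi; try exact: IHXi.
case: eqP => [w'E|_]; last exact: IHXi.
case: xNXi; rewrite w'E; apply/List.in_map_iff.
by exists (DeclDC w D1 D2).
Qed.

End Substitution.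

(** * The simplified context and validity of the emptying substitution *)

Section EmptyDirt.
Variables (Op : choiceType) (Sigma : {fset Op}) (Xi : ctx Op) (F : polarity).
Variable Dset : {fset dvar}.
Hypothesis applies : emptyDirt_applies Sigma Xi F Dset.

Let Xi' := emptyDirt_ctx Xi Dset.
Let s := emptyDirt_subst Xi Dset.

Lemma emptyDirt_wf_skel S : wf_skel Xi S -> wf_skel Xi' S.
Proof.
elim: S => //= [x xXi|S1 IH1 S2 IH2 [/IH1 ? /IH2 ?] //].
exact/In_filter.
Qed.

Lemma emptyDirt_wf_dirt D :
  wf_dirt Sigma Xi D -> wf_dirt Sigma Xi' (sub_dirt s D).
Proof.
case: D => O [d|] [/= OS d_wf]; last by split.
rewrite /sub_dirt /= /emptyDirt_sd.
case: ifPn => dD; split; rewrite /= ?fsetU0 //.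
exact/In_filter.
Qed.

(** Restricted to type parameters because the dirts inside an arrow type may mention emptied
    parameters; in a reduced context the bounds of type coercion parameters are type parameters. *)
Lemma emptyDirt_TVar_skel a S :
  vty_skel Sigma Xi (TVar a) S -> vty_skel Sigma Xi' (TVar a) S.
Proof.
move=> aS; inversion aS; subst; constructor; last exact: emptyDirt_wf_skel.
exact/In_filter.
Qed.

Lemma dc_lhs w D1 D2 : List.In (DeclDC w D1 D2) Xi ->
  exists d, D1 = DVar Op d /\ dirt_var_in Dset D1 = (d \in Dset).
Proof.
have [_ _ red_dc] := emptyDirt_reduced applies.
by move=> /red_dc [d ->]; exists d; split.
Qed.

(** Contrapositive of [emptyDirt_closed]: an emptied tail on the right would force the left
    parameter to be emptied too. *)
Lemma dc_kept_rhs w D1 D2 :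
  List.In (DeclDC w D1 D2) Xi -> ~~ dirt_var_in Dset D1 ->
  if dtail D2 is Some d then d \notin Dset else true.
Proof.
move=> wXi; have [d1 [D1E ->]] := dc_lhs wXi => d1N.
case: D2 wXi => O [d|] //=; rewrite D1E => wXi.
exact: contra (emptyDirt_closed applies wXi) d1N.
Qed.

Lemma emptyDirt_sub_id D :
  (if dtail D is Some d then d \notin Dset else true) -> sub_dirt s D = D.
Proof.
case: D => O [d|] //= dN.
by rewrite /sub_dirt /= /emptyDirt_sd (negbTE dN) /= fsetU0.
Qed.

(** Hence a kept coercion parameter retains its declared inequality and can be mapped to itself. *)
Lemma dc_kept_sub w D1 D2 :
  List.In (DeclDC w D1 D2) Xi -> ~~ dirt_var_in Dset D1 ->
  sub_dirt s D1 = D1 /\ sub_dirt s D2 = D2.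
Proof.
move=> wXi D1N; split; last exact/emptyDirt_sub_id/(dc_kept_rhs wXi).
by have [d [D1E D1in]] := dc_lhs wXi; apply: emptyDirt_sub_id;
  rewrite D1in D1E in D1N *.
Qed.

Lemma dc_emptied_sub w D1 D2 :
  List.In (DeclDC w D1 D2) Xi -> dirt_var_in Dset D1 ->
  sub_dirt s D1 = DEmpty.
Proof.
move=> /dc_lhs [d [-> ->]] dD.
by rewrite sub_dirt_DVar /= /emptyDirt_sd dD.
Qed.

Lemma emptyDirt_sdc w D1 D2 : List.In (DeclDC w D1 D2) Xi ->
  sdc s w =
    if dirt_var_in Dset D1 then dco_empty (sub_dirt s D2) else DCVar w.
Proof.
have [Xi_uniq _ _ _] := emptyDirt_wf applies.
by move=> wXi; rewrite /= (dc_boundsP Xi_uniq wXi).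
Qed.

Lemma emptyDirt_wf_ctx : wf_ctx Sigma Xi'.
Proof.
have [Xi_uniq wf_t wf_dc wf_tc] := emptyDirt_wf applies.
have [_ red_tc _] := emptyDirt_reduced applies.
split=> [|a S|w D1 D2|w A1 A2] /=.
- exact: NoDup_map_filter.
- by move=> /In_filter [aXi _]; apply: emptyDirt_wf_skel; apply: wf_t aXi.
- move=> /In_filter [wXi /= D1N].
  have [D1wf D2wf] := wf_dc _ _ _ wXi.
  have [<- <-] := dc_kept_sub wXi D1N.
  by split; apply: emptyDirt_wf_dirt.
- move=> /In_filter [wXi _].
  have [S [A1S A2S]] := wf_tc _ _ _ wXi.
  have [a1 [a2 [A1E A2E]]] := red_tc _ _ _ wXi.
  by exists S; subst; split; apply: emptyDirt_TVar_skel.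
Qed.

Lemma emptyDirt_valid : valid_subst Sigma s Xi Xi'.
Proof.
have [Xi_uniq wf_t wf_dc wf_tc] := emptyDirt_wf applies.
have [red_t red_tc _] := emptyDirt_reduced applies.
split; [exact: emptyDirt_wf applies | exact: emptyDirt_wf_ctx | | | | |].
- by move=> x xXi; apply/In_filter.
- move=> d dXi; rewrite -sub_dirt_DVar; apply: emptyDirt_wf_dirt.
  by split=> //=; apply: fsub0set.
- move=> a S aXi; have [x SE] := red_t _ _ aXi.
  (* By reducedness [S] is a skeleton parameter, which [s] fixes. *)
  suff -> : sub_skel s S = S.
    apply: emptyDirt_TVar_skel; constructor=> //; exact: wf_t aXi.
  by rewrite SE.
- move=> w D1 D2 wXi; rewrite (emptyDirt_sdc wXi).
  have [D1wf D2wf] := wf_dc _ _ _ wXi.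
  case: ifPn => D1in.
    rewrite (dc_emptied_sub wXi D1in); exact/dco_emptyP/emptyDirt_wf_dirt.
  apply: DL_var; try exact: emptyDirt_wf_dirt.
  by have [-> ->] := dc_kept_sub wXi D1in; apply/In_filter.
- move=> w A1 A2 wXi.
  have [S [A1S A2S]] := wf_tc _ _ _ wXi.
  have [a1 [a2 [A1E A2E]]] := red_tc _ _ _ wXi; subst.
  apply: (@VL_var _ _ _ _ _ _ S); try exact: emptyDirt_TVar_skel.
  exact/In_filter.
Qed.

(** * Instantiations of the simplified context and the coercion family *)

Section Instantiation.
Variables (Xiuse : ctx Op) (eta : subst Op).
Hypothesis eta_valid : valid_subst Sigma eta Xi Xiuse.

Lemma emptyDirt_restrict_valid : valid_subst Sigma eta Xi' Xiuse.
Proof.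
case: eta_valid => _ Xiuse_wf eta_s eta_d eta_t eta_dc eta_tc.
split=> //; first exact: emptyDirt_wf_ctx.
- by move=> x /In_filter [/eta_s].
- by move=> d /In_filter [/eta_d].
- by move=> a S /In_filter [/eta_t].
- by move=> w D1 D2 /In_filter [/eta_dc].
- by move=> w A1 A2 /In_filter [/eta_tc].
Qed.

Lemma emptyDirt_comp_valid : valid_subst Sigma (sub_comp eta s) Xi Xiuse.
Proof.
have [_ _ wf_dc _] := emptyDirt_wf applies.
have [red_t red_tc _] := emptyDirt_reduced applies.
have [_ _ _ eta_d' _ _ _] := emptyDirt_restrict_valid.
case: eta_valid => Xi_wf Xiuse_wf eta_s eta_d eta_t eta_dc eta_tc.
split=> //.
- move=> d dXi; rewrite /= /emptyDirt_sd.
  case: ifP => _; last by rewrite sub_dirt_DVar; apply: eta_d.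
  by split=> //=; apply: fsub0set.
- move=> a S aXi; have [x SE] := red_t _ _ aXi; subst.
  exact: eta_t aXi.
- move=> w D1 D2 wXi; rewrite !sub_dirt_comp.
  change (sdc (sub_comp eta s) w) with (sub_dco eta (sdc s w)).
  rewrite (emptyDirt_sdc wXi).
  have [_ D2wf] := wf_dc _ _ _ wXi.
  case: ifPn => D1in.
    rewrite (dc_emptied_sub wXi D1in).
    (* The dirt [sub_dirt s D2] lives in the simplified context, so [eta] is used there through its
       restriction. *)
    exact: sub_dco_empty eta_d' (emptyDirt_wf_dirt D2wf).
  by have [-> ->] := dc_kept_sub wXi D1in; apply: eta_dc.
- move=> w A1 A2 wXi.
  have [a1 [a2 [A1E A2E]]] := red_tc _ _ _ wXi; subst.
  exact: eta_tc wXi.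
Qed.

Definition emptyDirt_family : cofamily Op :=
  Cofamily (fun a => vco_refl (st eta a))
    (fun d => if d \in Dset then dco_empty (sd eta d) else dco_refl (sd eta d)).

Lemma emptyDirt_family_le :
  family_le Sigma Xi Xiuse emptyDirt_family F (sub_comp eta s) eta.
Proof.
have [pos_t pos_d] := emptyDirt_pos applies.
have [neg_t neg_d] := emptyDirt_neg applies.
have eta_d := valid_sd eta_valid; have eta_t := valid_st eta_valid.
split; [exact: emptyDirt_comp_valid | exact: eta_valid | | | |].
- by move=> a /pos_t [S /eta_t aS]; apply: vco_reflP aS.
- move=> d /pos_d /eta_d d_wf; rewrite /= /emptyDirt_sd.
  case: ifP => _; first exact: dco_emptyP.
  by rewrite sub_dirt_DVar; apply: dco_reflP.
- by move=> a /neg_t [S /eta_t aS]; apply: vco_reflP aS.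
- move=> d dF; rewrite /= /emptyDirt_sd.
  (* A negative emptied parameter would need a coercion from [sd eta d] down to the empty dirt,
     which need not exist; [emptyDirt_nonneg] excludes this case. *)
  case: ifP => [dD|_].
    by rewrite (negbTE (emptyDirt_nonneg applies dD)) in dF.
  by rewrite sub_dirt_DVar; apply: dco_reflP; apply: eta_d; apply: neg_d.
Qed.

End Instantiation.
End EmptyDirt.

Theorem proposition5p5 (Op : choiceType) (Sigma : {fset Op}) (Xiuse : ctx Op)
    (Xiuse_wf : wf_ctx Sigma Xiuse) :
  is_phase Sigma (emptyDirt Sigma) /\
  complete Sigma Xiuse (emptyDirt Sigma).
Proof.
split=> [Xi F Xi' s [Dset [applies -> ->]]|].
  exact: emptyDirt_valid applies.
move=> Xi F Xi' s [Dset [applies -> ->]] eta eta_valid.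
exists eta, (emptyDirt_family Dset eta); split.
  exact (emptyDirt_restrict_valid applies eta_valid).
exact (emptyDirt_family_le applies eta_valid).
Qed.
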